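(* For every positive integer $c$, if $n>10(30c+52)$ and $P$ is any finite poset with $|P|\le 2n+1$ and $\dim^*(P)\ge n-c$, then $P$ contains a standard example $S_d$ with $d\ge n-(30c+52)$.
   Context: With $L_1,\dots,L_N$ all linear extensions of $P$, the fractional dimension $\dim^*(P)$ is the least real $d$ such that there are non-negative reals $\alpha_1,\dots,\alpha_N$ with $\sum_i\alpha_i=d$ and, for every ordered pair $(x,y)$ of incomparable elements, $\sum\{\alpha_i: x>y\text{ in }L_i\}\ge1$. The standard example $S_d$ has minimal elements $a_1,\dots,a_d$ and maximal elements $b_1,\dots,b_d$ with $a_i<b_j$ iff $i\ne j$; ''contains'' means has a subposet isomorphic to $S_d$. *)

(* Defs.v *)
From HB Require Import structures.
From mathcomp Require Import all_boot all_order all_algebra.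
From mathcomp Require Import all_classical all_reals all_analysis.

Set Implicit Arguments.
Unset Strict Implicit.
Unset Printing Implicit Defensive.

Import Order.TTheory GRing.Theory Num.Theory.
Import numFieldNormedType.Exports.

Local Open Scope classical_set_scope.
Local Open Scope order_scope.
Local Open Scope ring_scope.

(* (x, y) \in L reads: x <= y in L. *)
Definition is_partial_order (T : finType) (L : {set T * T}) : Prop :=
  [/\ forall x, (x, x) \in L,
      forall x y, (x, y) \in L -> (y, x) \in L -> x = y
    & forall x y z, (x, y) \in L -> (y, z) \in L -> (x, z) \in L].

Definition is_linear_extension (disp : Order.disp_t)
    (P : finPOrderType disp) (L : {set P * P}) : Prop :=
  [/\ is_partial_order L,
      forall x y, ((x, y) \in L) || ((y, x) \in L)
    & forall x y : P, (x <= y)%O -> (x, y) \in L].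

Definition linear_extension (disp : Order.disp_t) (P : finPOrderType disp) :=
  {L : {set P * P} | `[< is_linear_extension L >]}.

Definition gt_in (disp : Order.disp_t) (P : finPOrderType disp)
    (L : linear_extension P) (x y : P) : bool :=
  (x != y) && ((y, x) \in val L).

Definition fractional_realizer (R : realType) (disp : Order.disp_t)
    (P : finPOrderType disp) (alpha : linear_extension P -> R) : Prop :=
  (forall L, 0 <= alpha L) /\
  (forall x y : P, (x >< y)%O ->
     1 <= \sum_(L : linear_extension P | gt_in L x y) alpha L).

Definition fractional_weight (R : realType) (disp : Order.disp_t)
    (P : finPOrderType disp) : set R :=
  [set d | exists2 alpha : linear_extension P -> R,
     fractional_realizer alpha & \sum_(L : linear_extension P) alpha L = d].

(* The infimum is attained: see fdim_least. *)
Definition fdim (R : realType) (disp : Order.disp_t)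
    (P : finPOrderType disp) : R := inf (@fractional_weight R disp P).

Lemma partial_order_add (T : finType) (L : {set T * T}) (x y : T) :
  is_partial_order L -> (x, y) \notin L ->
  exists L' : {set T * T},
    [/\ is_partial_order L', L \subset L' & (y, x) \in L'].
Proof.
move=> [Lr La Lt] xy.
exists (L :|: [set p | ((p.1, y) \in L) && ((x, p.2) \in L)]).
split; [split | exact: finset.subsetUl | by rewrite !inE/= !Lr orbT].
- by move=> u; rewrite inE Lr.
- move=> u v; rewrite !inE/= => /orP[uv|/andP[uy xv]] /orP[vu|/andP[vy xu]].
  + exact: La.
  + by case/negP: xy; exact: Lt (Lt _ _ _ xu uv) vy.
  + by case/negP: xy; exact: Lt (Lt _ _ _ xv vu) uy.
  + by case/negP: xy; exact: Lt xv vy.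
- move=> u v w; rewrite !inE/= => /orP[uv|/andP[uy xv]] /orP[vw|/andP[vy xw]].
  + by rewrite (Lt _ _ _ uv vw).
  + by rewrite (Lt _ _ _ uv vy) xw orbT.
  + by rewrite uy (Lt _ _ _ xv vw) orbT.
  + by rewrite uy xw orbT.
Qed.

Lemma partial_order_total (T : finType) (L : {set T * T}) :
  is_partial_order L ->
  exists L' : {set T * T}, [/\ is_partial_order L', L \subset L'
    & forall x y, ((x, y) \in L') || ((y, x) \in L')].
Proof.
have [n] := ubnP (#|~: L|); elim: n L => // n IH L Ln Lo.
have [[p pL]|tot] := pselect (exists p, (p \notin L) && ((p.2, p.1) \notin L)).
  case: p pL => x y /= /andP[xy yx].
  have [L1 [L1o LL1 yxL1]] := partial_order_add Lo xy.
  have [|L2 [L2o L12 L2t]] := IH L1 _ L1o; last first.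
    by exists L2; split=> //; exact: fintype.subset_trans L12.
  rewrite -ltnS; apply: leq_trans Ln; rewrite ltnS.
  apply: proper_card; rewrite finset.properC; apply/properP; split=> //.
  by exists (y, x).
exists L; split=> // x y; apply/negP => /negP; rewrite negb_or => h.
by apply: tot; exists (x, y).
Qed.

Lemma linear_extension_reversing (disp : Order.disp_t)
    (P : finPOrderType disp) (x y : P) :
  (x >< y)%O -> exists L : linear_extension P, gt_in L x y.
Proof.
move=> xy.
pose L0 : {set P * P} := [set p | (p.1 <= p.2)%O]%SET.
have L0o : is_partial_order L0.
  split; first by move=> u; rewrite inE/=.
  - by move=> u v; rewrite !inE/= => uv vu; apply/eqP; rewrite eq_le uv.
  - by move=> u v w; rewrite !inE/=; exact: le_trans.
have xyL0 : (x, y) \notin L0.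
  by rewrite inE/=; apply: contraNN xy => xy; rewrite /Order.comparable xy.
have [L1 [L1o L01 yxL1]] := partial_order_add L0o xyL0.
have [L2 [L2o L12 L2t]] := partial_order_total L1o.
have L2l : `[< is_linear_extension L2 >].
  apply/asboolP; split=> // u v uv.
  by apply/(fintype.subsetP L12)/(fintype.subsetP L01); rewrite inE.
exists (exist _ L2 L2l); rewrite /gt_in/= (fintype.subsetP L12 _ yxL1) andbT.
by apply: contraNneq xy => ->; rewrite /Order.comparable lexx.
Qed.

Lemma fractional_weight_neq0 (R : realType) (disp : Order.disp_t)
    (P : finPOrderType disp) : @fractional_weight R disp P !=set0.
Proof.
exists (\sum_(L : linear_extension P) 1); exists (fun=> 1) => //.
split=> [L|x y xy]; first exact: ler01.
have [L Lxy] := linear_extension_reversing xy.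
by rewrite (bigD1 L)//= lerDl; apply: sumr_ge0.
Qed.

Lemma fractional_weight_has_min (R : realType) (disp : Order.disp_t)
    (P : finPOrderType disp) : exists2 d : R, @fractional_weight R disp P d
    & lbound (@fractional_weight R disp P) d.
Proof.
have [M [a0 [a0_ge0 a0_rev] sa0]] := fractional_weight_neq0 R P.
pose X := prod_topology (fun _ : linear_extension P => R).
pose K : set X := [set f | forall L, `[0, M]%classic (f L)].
have cK : compact K.
  exact: (@tychonoff _ (fun _ => R) (fun _ => `[0, M]%classic)
            (fun _ => @segment_compact R 0 M)).
have csum (Q : pred (linear_extension P)) :
    continuous (fun f : X => \sum_(L | Q L) f L).
  apply: continuous_big => [|L _].
    exact: add_continuous.
  exact: (@proj_continuous _ (fun _ => R) L).
pose C : set X := \bigcap_(p in [set p : P * P | (p.1 >< p.2)%O])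
  [set f : X | 1 <= \sum_(L | gt_in L p.1 p.2) f L].
have clC : closed C.
  apply: closed_bigI => p _.
  apply: (@preimage_closed _ _ _ [set x : R | 1 <= x]); last exact: closed_ge.
  by move=> f _; exact: csum.
have leM (a : X) L : (forall L, 0 <= a L) -> a L <= \sum_L a L.
  by move=> a_ge0; rewrite (bigD1 L)//= lerDl; apply: sumr_ge0.
have KCa0 : (K `&` C) a0.
  split=> [L|[x y] xy] /=; last exact: a0_rev.
  by rewrite in_itv/= a0_ge0 -sa0 leM.
have [|||a] := @compact_EVT_min X R (fun f : X => \sum_L f L) (K `&` C).
- by exists a0.
- exact: compact_closedI.
- by apply: continuous_subspaceT; exact: csum.
rewrite inE => -[Ka Ca] amin.
exists (\sum_L a L).
  exists a => //; split=> [L|x y xy]; last exact: (Ca (x, y)).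
  by have := Ka L; rewrite /= in_itv/= => /andP[].
move=> _ [b [b_ge0 b_rev] <-].
have [bM|/ltW Mb] := leP (\sum_L b L) M.
  apply: amin; rewrite inE; split=> [L|[x y] xy] /=; last exact: b_rev.
  by rewrite in_itv/= b_ge0 (le_trans _ bM)// leM.
by apply: le_trans Mb; rewrite -sa0; apply: amin; rewrite inE.
Qed.

Lemma fdim_least (R : realType) (disp : Order.disp_t)
    (P : finPOrderType disp) : @fractional_weight R disp P (fdim R P) /\
  lbound (@fractional_weight R disp P) (fdim R P).
Proof.
have [d wd dmin] := fractional_weight_has_min R P.
suff -> : fdim R P = d by [].
apply/eqP; rewrite eq_le ge_inf//; last by exists d.
by rewrite lb_le_inf//; exists d.
Qed.

(* inl i is the minimal element a_i and inr j the maximal element b_j. *)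
Definition standard_example (d : nat) : Type := ('I_d + 'I_d)%type.

HB.instance Definition _ (d : nat) := Finite.on (standard_example d).

Definition standard_example_le (d : nat) : rel (standard_example d) :=
  fun u v => match u, v with
             | inl i, inr j => i != j
             | _, _ => u == v
             end.

Lemma standard_example_le_refl d : reflexive (@standard_example_le d).
Proof. by case=> i /=. Qed.

Lemma standard_example_le_anti d : antisymmetric (@standard_example_le d).
Proof. by case=> i [] j //= /andP[/eqP]. Qed.

Lemma standard_example_le_trans d : transitive (@standard_example_le d).
Proof.
by case=> j [] i [] k //=;
  [move/eqP=> -> | move/eqP=> [->] | move=> ij /eqP[<-] | move/eqP=> ->].
Qed.

Fact standard_example_display : Order.disp_t.
Proof. exact: (Order.Disp tt tt). Qed.

HB.instance Definition _ (d : nat) :=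
  Order.Le_isPOrder.Build standard_example_display (standard_example d)
    (@standard_example_le_refl d) (@standard_example_le_anti d)
    (@standard_example_le_trans d).

(* {mono f} makes f an order embedding, hence injective. *)
Definition contains_standard_example (disp : Order.disp_t)
    (P : finPOrderType disp) (d : nat) : Prop :=
  exists f : standard_example d -> P, {mono f : u v / (u <= v)%O}.

(* Main.v *)
(** Clearing denominators, [fdim P >= N] says that every list of linear
extensions reversing each incomparable pair at least [k] times has at least
[k * N] members, so it suffices to exhibit short lists.

Chains of a Dilworth cover give an antichain [A] with [|A| >= n - c]; let [D]
and [U] be the elements below and above it. Two extensions ordering [D < A < U]
reverse everything but the pairs [d > _], [a > u], and half of the pairs
[u > u']. Putting each [u] at the bottom and each [d] at the top costs
[|D| + |U| <= n + c + 1]. For any [d, u, u'], seven extensions do three times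
the work of these three elements, which saves 2 out of 9; hence [D] or [U] (up
to duality [D]) has [O(c)] elements.

In the bipartite graph of incomparable pairs between [A] and [U], one extension
serves both ends of an edge. Hence a path with two edges serves its three
vertices with two extensions, so a maximal family of [K] disjoint such paths has
[K = O(c)]. Outside of it the graph is a matching, that is, a standard example;
serving its edges and the [K] paths already gives a fractional realizer, so the
matching has at least [n - O(c)] edges. *)

Require Import Defs.
From mathcomp Require Import all_boot zify.

Set Implicit Arguments.
Unset Strict Implicit.
Unset Printing Implicit Defensive.

(** * Dilworth's theorem *)

Section Poset.
Variables (T : finType) (le : rel T).
Hypotheses (le_refl : reflexive le) (le_anti : antisymmetric le)
  (le_trans : transitive le).

Definition antichain (A : {set T}) :=
  [forall x in A, forall y in A, le x y ==> (x == y)].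

Lemma antichainP (A : {set T}) :
  reflect {in A &, forall x y, le x y -> x = y} (antichain A).
Proof.
apply: (iffP forall_inP) => [h x y xA yA xy|h x xA].
  by have /forall_inP/(_ _ yA)/implyP/(_ xy)/eqP := h _ xA.
by apply/forall_inP => y yA; apply/implyP => xy; apply/eqP/h.
Qed.

(** A strictly increasing rank: it yields minimal and maximal elements and, in [idx], a linear
    refinement of the order. *)
Lemma card_down_lt (x y : T) :
  le x y -> x != y -> #|[set z | le z x]| < #|[set z | le z y]|.
Proof.
move=> xy nxy; apply/proper_card/properP; split.
  by apply/subsetP => z; rewrite !inE => zx; exact: le_trans xy.
exists y; rewrite ?inE ?le_refl //.
by apply: contra nxy => yx; apply/eqP/le_anti; rewrite xy.
Qed.

(** Elements of an antichain sharing a colour would be equal, so [k] of them use up all [k]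
    colours. *)
Lemma coloring_onto (A : {set T}) (col : T -> nat) (k : nat) :
  antichain A -> #|A| = k -> (forall x, x \in A -> col x < k) ->
  {in A &, forall x y, col x = col y -> le x y || le y x} ->
  forall i, i < k -> exists2 a, a \in A & col a = i.
Proof.
move=> /antichainP Aa Ak colk colc i ik.
have u : uniq (map col (enum A)).
  rewrite map_inj_in_uniq ?enum_uniq // => x y; rewrite !mem_enum => xA yA e.
  by case/orP: (colc _ _ xA yA e) => h; [apply: Aa|apply/esym/Aa].
have [||_ e] := @uniq_min_size _ _ (iota 0 k) u.
- by move=> _ /mapP[x xA ->]; rewrite mem_iota /= colk // -mem_enum.
- by rewrite size_iota size_map -cardE Ak.
have : i \in map col (enum A) by rewrite e mem_iota.
by case/mapP => a; rewrite mem_enum => aA ->; exists a.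
Qed.

(* Perles' proof: either a maximum antichain splits S into two smaller sets,
   whose chain covers are glued along it, or removing a chain made of a minimal
   and a maximal element lowers the width. *)
Lemma dilworth (k : nat) (S : {set T}) :
  (forall A : {set T}, A \subset S -> antichain A -> #|A| <= k) ->
  exists2 col : T -> nat, forall x, x \in S -> col x < k
    & {in S &, forall x y, col x = col y -> le x y || le y x}.
Proof.
have [n] := ubnP #|S|; elim: n => // n IH in k S * => Sn wS.
have pS (B : {set T}) : B \proper S -> #|B| < n.
  by move/proper_card => BS; rewrite -ltnS; apply: leq_trans Sn.
have [->|[x0 x0S]] := set_0Vmem S.
  by exists (fun=> 0) => x; rewrite ?inE // => y; rewrite inE.
(* Splitting case: [xm] is above no element of [A] and [xp] below none, so [Sp] and [Sm] are both
   smaller than [S]. *)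
have [/existsP[A /and5P[AS Aa /eqP Ak /exists_inP[xm xmS /forall_inP xmA]
    /exists_inP[xp xpS /forall_inP xpA]]]|noA] :=
  boolP [exists A : {set T}, [&& A \subset S, antichain A, #|A| == k,
    [exists x in S, [forall a in A, ~~ le a x]]
    & [exists x in S, [forall a in A, ~~ le x a]]]].
  have /antichainP Aa' := Aa.
  pose Sp := [set x in S | [exists a in A, le a x]].
  pose Sm := [set x in S | [exists a in A, le x a]].
  have SpS : Sp \subset S by apply/subsetP => x; rewrite inE => /andP[].
  have SmS : Sm \subset S by apply/subsetP => x; rewrite inE => /andP[].
  have ASp : A \subset Sp.
    apply/subsetP => x xA; rewrite inE (subsetP AS) //=.
    by apply/exists_inP; exists x.
  have ASm : A \subset Sm.
    apply/subsetP => x xA; rewrite inE (subsetP AS) //=.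
    by apply/exists_inP; exists x.
  have [||colp colpk colpc] := IH k Sp.
  - apply/pS/properP; split=> //; exists xm => //.
    rewrite inE xmS /=; apply/exists_inP => -[a aA]; exact/negP/xmA.
  - by move=> B BS; apply: wS; exact: subset_trans SpS.
  have [||colm colmk colmc] := IH k Sm.
  - apply/pS/properP; split=> //; exists xp => //.
    rewrite inE xpS /=; apply/exists_inP => -[a aA]; exact/negP/xpA.
  - by move=> B BS; apply: wS; exact: subset_trans SmS.
  have onto : forall i, i < k -> exists2 a, a \in A & colm a = i.
    apply: (coloring_onto Aa Ak) => [x xA|x y xA yA].
      by apply: colmk; exact: (subsetP ASm).
    by apply: colmc; exact: (subsetP ASm).
  (* The element of [A] on the lower chain of [x], where an upper chain takes over. The default
     never occurs for [x] in [S] outside [Sp]. *)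
  pose rep x := odflt x [pick a in A | colm a == colm x].
  have repP x : x \in S -> x \notin Sp ->
      [/\ rep x \in A, le x (rep x), colm (rep x) = colm x & x \in Sm].
    move=> xS xSp.
    have xSm : x \in Sm.
      rewrite inE xS /=; apply: contraT => /exists_inP nx.
      have xA : x \notin A by apply: contra xSp; exact: (subsetP ASp).
      have : #|x |: A| <= k.
        apply: wS; first by rewrite subUset sub1set xS.
        apply/antichainP => y z; rewrite !inE.
        case/orP=> [/eqP->|yA] /orP[/eqP->|zA] // yz; last exact: Aa'.
          by case: nx; exists z.
        by case/negP: xSp; rewrite inE xS; apply/exists_inP; exists y.
      by rewrite cardsU1 xA Ak add1n ltnn.
    rewrite /rep; case: pickP => [a /= /andP[aA /eqP e]|h] /=; last first.
      have [a aA e] := onto _ (colmk _ xSm).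
      by have := h a; rewrite /= aA e eqxx.
    split=> //; have /orP[//|ax] := colmc _ _ xSm (subsetP ASm _ aA) (esym e).
    by case/negP: xSp; rewrite inE xS; apply/exists_inP; exists a.
  pose col x := if x \in Sp then colp x else colp (rep x).
  (* Even if [x] is below [rep y], the element of [A] under [x] must then be [rep y], so [x] is
     above it in any case. *)
  have mixed x y : x \in Sp -> y \in S -> y \notin Sp ->
      colp x = colp (rep y) -> le y x.
    move=> xSp yS ySp e; have [rA yr _ _] := repP _ yS ySp.
    apply: le_trans yr _.
    have /orP[xr|//] := colpc _ _ xSp (subsetP ASp _ rA) e.
    have := xSp; rewrite inE => /andP[_ /exists_inP[a aA ax]].
    by rewrite -(Aa' _ _ aA rA (le_trans ax xr)).
  exists col => [x xS|x y xS yS]; rewrite /col.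
    case: ifPn => [|xSp]; first exact: colpk.
    by have [rA _ _ _] := repP _ xS xSp; apply/colpk/(subsetP ASp).
  case: ifPn => [xSp|xSp]; case: ifPn => [ySp|ySp] e.
  - exact: colpc.
  - by rewrite (mixed x y) ?orbT.
  - by rewrite (mixed y x).
  - have [rxA _ ex xSm] := repP _ xS xSp; have [ryA _ ey ySm] := repP _ yS ySp.
    apply: colmc => //; rewrite -ex -ey; congr colm.
    have /orP[h|h] := colpc _ _ (subsetP ASp _ rxA) (subsetP ASp _ ryA) e.
      exact: Aa'.
    by apply/esym/Aa'.
pose down x := #|[set z | le z x]|.
have [m mS mmin] := @arg_minnP _ x0 [pred x | x \in S] down x0S.
rewrite inE in mS.
have mcond : (m \in S) && le m m by rewrite mS le_refl.
have [M /= /andP[MS mM] Mmax] :=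
  @arg_maxnP _ m [pred y | (y \in S) && le m y] down mcond.
have minm z : z \in S -> le z m -> z = m.
  move=> zS zm; apply/eqP/negPn/negP => /(card_down_lt zm).
  by rewrite ltnNge mmin.
have maxM z : z \in S -> le M z -> z = M.
  move=> zS Mz; apply/eqP/negPn/negP; rewrite eq_sym => /(card_down_lt Mz).
  by rewrite ltnNge Mmax //= zS (le_trans mM).
have k_gt0 : 0 < k.
  rewrite -(cards1 m); apply: wS; first by rewrite sub1set.
  by apply/antichainP => x y /set1P-> /set1P->.
have S'S : S :\ m :\ M \subset S.
  by rewrite (subset_trans (subsetDl _ _)) ?subsetDl.
(* An antichain of size [k] avoiding [m] and [M] would be one of the excluded [A]: by extremality,
   [m] is above and [M] below none of its elements. *)
have [||col colk colc] := IH k.-1 (S :\ m :\ M).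
- apply/pS/properP; split=> //.
  by exists m; rewrite // !inE eqxx andbF.
- move=> A AS' Aa; have AS := subset_trans AS' S'S.
  rewrite -ltnS prednK // ltn_neqAle wS // andbT.
  apply: contra noA => Ak; apply/existsP; exists A; rewrite AS Aa Ak /=.
  apply/andP; split; apply/exists_inP; [exists m | exists M] => //.
    apply/forall_inP => a aA; apply/negP => /minm e.
    have := subsetP AS' _ aA; rewrite e ?(subsetP AS) //.
    by rewrite !inE eqxx andbF.
  apply/forall_inP => a aA; apply/negP => /maxM e.
  have := subsetP AS' _ aA; rewrite e ?(subsetP AS) //.
  by rewrite !inE eqxx.
exists (fun x => if x \in [set m; M] then k.-1 else col x) => [x xS|x y xS yS].
  case: ifPn => [_|]; first by rewrite prednK.
  rewrite !inE negb_or => /andP[xm xM].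
  have := colk x; rewrite !inE xm xM xS => /(_ isT) h.
  by apply: leq_trans h (leq_pred _).
have colk' z : z \in S -> z \notin [set m; M] ->
    z \in S :\ m :\ M /\ col z < k.-1.
  rewrite !inE negb_or => zS /andP[zm zM].
  by have := colk z; rewrite !inE zm zM zS => /(_ isT).
case: ifPn => [xm|xm]; case: ifPn => [ym|ym].
- move: xm ym; rewrite !inE.
  by case/orP=> /eqP-> /orP[]/eqP->; rewrite ?le_refl ?mM ?orbT.
- by have [_ h] := colk' _ yS ym; move=> e; rewrite e ltnn in h.
- by have [_ h] := colk' _ xS xm; move=> e; rewrite e ltnn in h.
- by move=> e; apply: colc => //; [case: (colk' _ xS xm)|case: (colk' _ yS ym)].
Qed.

(** * Covers by isotone maps *)

Definition isotone (g : T -> nat) :=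
  [forall x, forall y, le x y ==> (g x <= g y)].

Lemma isotoneP (g : T -> nat) :
  reflect (forall x y, le x y -> g x <= g y) (isotone g).
Proof.
by apply: (iffP forallP) => [h x y xy|h x];
  [have /forallP/(_ y)/implyP := h x; apply | apply/forallP => y; apply/implyP/h].
Qed.

Definition reverses (x y : T) (g : T -> nat) := g y < g x.

(* An isotone map stands for any linear extension refining its levels. *)
Definition covers (k : nat) (s : seq (T -> nat)) :=
  all isotone s /\
  forall x y, ~~ le x y -> ~~ le y x -> k <= count (reverses x y) s.

Definition dim_ge (N : nat) := forall k s, covers k s -> k * N <= size s.

(** The standard example written as four families of equations, which duality only permutes. *)
Definition standard_in (M : nat) := exists a u : 'I_M -> T, forall i j,
  [/\ le (a i) (u j) = (i != j), le (u i) (a j) = false,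
      le (a i) (a j) = (i == j) & le (u i) (u j) = (i == j)].

(** An extension with [y] as low as possible: only its down-set is on level 0. Dually, [up x] puts
    [x] as high as possible, and [up_dn] adds the two. *)
Definition dn (y z : T) : nat := ~~ le z y.
Definition up (x z : T) : nat := le x z.
Definition up_dn (x y z : T) : nat := dn y z + up x z.

Lemma dn_homo y x z : le x z -> dn y x <= dn y z.
Proof.
move=> xz; rewrite /dn; case: (boolP (le z y)) => [zy|_]; last exact: leq_b1.
by rewrite (le_trans xz zy).
Qed.

Lemma up_homo y x z : le x z -> up y x <= up y z.
Proof.
by move=> xz; rewrite /up; case: (boolP (le y x)) => // yx; rewrite (le_trans yx).
Qed.

Lemma isotone_dn y : isotone (dn y).
Proof. by apply/isotoneP; exact: dn_homo. Qed.

Lemma isotone_up x : isotone (up x).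
Proof. by apply/isotoneP; exact: up_homo. Qed.

Lemma isotone_up_dn x y : isotone (up_dn x y).
Proof. by apply/isotoneP => z w zw; rewrite leq_add ?dn_homo ?up_homo. Qed.

Lemma all_isotone_up l : all isotone (map up l).
Proof. by rewrite all_map; apply/allP => e _; exact: isotone_up. Qed.

Lemma all_isotone_dn l : all isotone (map dn l).
Proof. by rewrite all_map; apply/allP => e _; exact: isotone_dn. Qed.

Lemma reverses_dn x y : ~~ le x y -> reverses x y (dn y).
Proof. by rewrite /reverses /dn le_refl => ->. Qed.

Lemma reverses_up x y : ~~ le x y -> reverses x y (up x).
Proof. by rewrite /reverses /up le_refl => /negPf->. Qed.

(** Since [x] is not below [y], [x] reaches level 2 and [y] stays on level 0, so neither part of
    [up_dn] disturbs the other. *)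
Lemma reverses_up_dn_l x y z :
  ~~ le x y -> ~~ le x z -> reverses x z (up_dn x y).
Proof.
rewrite /reverses /up_dn /dn /up le_refl => -> /negPf->.
by case: (le z y).
Qed.

Lemma reverses_up_dn_r x y z :
  ~~ le x y -> ~~ le z y -> reverses z y (up_dn x y).
Proof. by rewrite /reverses /up_dn /dn /up le_refl => /negPf-> ->. Qed.

Lemma count_map_ge1 (I : eqType) (X : Type) (p : pred X) (F : I -> X) s i :
  i \in s -> p (F i) -> 1 <= count p (map F s).
Proof. by move=> si pi; rewrite count_map -has_count; apply/hasP; exists i. Qed.

Lemma count_map_ge2 (I : eqType) (X : Type) (p : pred X) (F : I -> X) s i j :
  i \in s -> j \in s -> i != j -> p (F i) -> p (F j) -> 2 <= count p (map F s).
Proof.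
move=> si sj ij pi pj; rewrite count_map -size_filter.
apply: (@uniq_leq_size _ [:: i; j]); first by rewrite /= inE ij.
by move=> l; rewrite !inE mem_filter => /orP[]/eqP->; rewrite /= ?pi ?pj.
Qed.

Lemma count_flatten_ge (I : eqType) (X : Type) (p : pred X)
    (F : I -> seq X) s i :
  i \in s -> count p (F i) <= count p (flatten (map F s)).
Proof.
elim: s => //= j s IH; rewrite inE count_cat => /orP[/eqP->|/IH h].
  exact: leq_addr.
exact: leq_trans h (leq_addl _ _).
Qed.

(** Dimension is at most width, by one extension for each chain of a Dilworth cover. The last claim
    holds because a maximum antichain is maximal. *)
Lemma dim_le_width (N : nat) : dim_ge N ->
  exists A : {set T}, [/\ antichain A, N <= #|A|
    & forall x, exists2 a, a \in A & le x a || le a x].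
Proof.
move=> dimN.
have a0 : antichain set0 by apply/antichainP => x y; rewrite inE.
have [A /= Aa Amax] :=
  @arg_maxnP _ set0 antichain (fun A : {set T} => #|A|) a0.
have [|col colk colc] := @dilworth #|A| setT.
  by move=> B _; exact: Amax.
(* This puts each element of chain [i] under everything incomparable to it: a chain element above
   [x] cannot lie below [y]. *)
pose g i z := #|[set c | (col c == i) && ~~ le z c]|.
exists A; split=> //.
  rewrite -[leqLHS]mul1n -[leqRHS](size_iota 0) -(size_map g).
  apply: dimN; split=> [|x y xy yx].
    rewrite all_map; apply/allP => i _ /=; apply/isotoneP => x y xy.
    apply/subset_leq_card/subsetP => c; rewrite !inE => /andP[->] /=.
    by apply: contra; exact: le_trans.
  apply: (@count_map_ge1 _ _ _ _ _ (col y)).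
    by rewrite mem_iota /= add0n colk ?inE.
  apply/proper_card/properP; split.
    apply/subsetP => c; rewrite !inE => /andP[cy yc]; rewrite cy /=.
    apply: contra xy => xc; apply: le_trans xc _.
    have /orP[//|] := colc _ _ (in_setT c) (in_setT y) (eqP cy).
    by rewrite (negPf yc).
  by exists y; rewrite !inE eqxx ?le_refl.
move=> x; have [xA|xA] := boolP (x \in A); first by exists x; rewrite ?le_refl.
have [/exists_inP[a aA h]|/exists_inP no] :=
  boolP [exists a in A, le x a || le a x]; first by exists a.
suff /Amax : antichain (x |: A) by rewrite cardsU1 xA add1n ltnn.
have /antichainP Aa' := Aa.
apply/antichainP => y z; rewrite !inE.
case/orP=> [/eqP->|yA] /orP[/eqP->|zA] // yz; last exact: Aa'.
  by case: no; exists z; rewrite ?yz.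
by case: no; exists y; rewrite ?yz ?orbT.
Qed.

(** * The layers of a maximal antichain *)

Section Layers.
Variable A : {set T}.
Hypothesis Aa : antichain A.
Hypothesis Amax : forall x, exists2 a, a \in A & le x a || le a x.

Let Aeq : {in A &, forall x y, le x y -> x = y}.
Proof. exact/antichainP. Qed.

Definition above := [set x | (x \notin A) && [exists a in A, le a x]].
Definition below := [set x | (x \notin A) && [exists a in A, le x a]].
Local Notation U := above.
Local Notation D := below.

Lemma aboveP x : x \in U -> x \notin A /\ exists2 a, a \in A & le a x.
Proof. by rewrite inE => /andP[-> /exists_inP]. Qed.

Lemma belowP x : x \in D -> x \notin A /\ exists2 a, a \in A & le x a.
Proof. by rewrite inE => /andP[-> /exists_inP]. Qed.

Lemma layersP x : [|| x \in D, x \in A | x \in U].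
Proof.
rewrite !inE; case: (boolP (x \in A)) => //= xA; rewrite ?orbT //.
have [a aA /orP[h|h]] := Amax x; apply/orP; [left|right];
  by apply/exists_inP; exists a.
Qed.

(** Otherwise [a <= x <= y <= b] with [a] and [b] in [A] forces [a = b], which puts [x] into [A]. *)
Lemma above_not_le x y : x \in U -> y \in A :|: D -> ~~ le x y.
Proof.
case/aboveP => xA [a aA ax]; rewrite inE => yAD; apply/negP => xy.
have [b bA yb] : exists2 b, b \in A & le y b.
  by case/orP: yAD => [yA|/belowP[_ //]]; exists y.
have e := Aeq aA bA (le_trans ax (le_trans xy yb)).
case/negP: xA; suff -> : x = a by [].
by apply: le_anti; rewrite ax e (le_trans xy).
Qed.

Lemma antichain_not_le_below x y : x \in A -> y \in D -> ~~ le x y.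
Proof.
move=> xA /belowP[yA [b bA yb]]; apply/negP => xy.
have e := Aeq xA bA (le_trans xy yb).
by case/negP: yA; rewrite (_ : y = x) //; apply: le_anti; rewrite xy e yb.
Qed.

Lemma disjoint_below_above x : x \in D -> x \notin U.
Proof.
move=> xD; apply/negP => xU; have := above_not_le xU.
by move/(_ x); rewrite inE xD orbT le_refl => /(_ isT).
Qed.

Lemma above_notin x : x \in U -> x \notin A. Proof. by case/aboveP. Qed.
Lemma below_notin x : x \in D -> x \notin A. Proof. by case/belowP. Qed.

Lemma card_layers : #|A| + #|D| + #|U| = #|T|.
Proof.
rewrite -addnA -(cardsC A); congr (_ + _).
have -> : ~: A = D :|: U.
  apply/setP => x; rewrite inE in_setU; have := layersP x.
  case: (boolP (x \in D)) => [/below_notin->//|_].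
  by case: (boolP (x \in U)) => [/above_notin->//|_]; rewrite orbF /= => ->.
rewrite cardsU; suff -> : D :&: U = set0 by rewrite cards0 subn0.
apply/setP => x; rewrite in_setI in_set0.
by case: (boolP (x \in D)) => //= /disjoint_below_above/negPf->.
Qed.

(* Any linear order of T refining le would do. *)
Definition idx (x : T) := #|[set z | le z x]| * #|T| + enum_rank x.

Lemma idx_homo x y : le x y -> idx x <= idx y.
Proof.
move=> xy; have [->//|nxy] := eqVneq x y.
have h := card_down_lt xy nxy; have := ltn_ord (enum_rank x).
rewrite /idx; set p := #|_|; set q := #|_| in h *; nia.
Qed.

Lemma idx_inj : injective idx.
Proof.
move=> x y e; apply/enum_rank_inj/val_inj => /=.
have := congr1 (modn^~ #|T|) e; rewrite /idx !modnMDl.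
by rewrite !modn_small ?ltn_ord.
Qed.

Lemma idx_lt x : idx x < #|T|.+1 * #|T|.
Proof.
rewrite /idx mulSn addnC -addSn leq_add ?ltn_ord //.
by rewrite leq_mul2r max_card orbT.
Qed.

Definition layer x := if x \in D then 0 else if x \in A then 1 else 2.

Lemma layer_homo x y : le x y -> layer x <= layer y.
Proof.
rewrite /layer => xy.
have [//|xD] := boolP (x \in D); have := layersP x; rewrite (negPf xD) /=.
have [yD|yD] := boolP (y \in D).
  case/orP=> [xA|xU].
    by have := antichain_not_le_below xA yD; rewrite xy.
  by have := @above_not_le x y xU; rewrite inE yD orbT xy => /(_ isT).
have [_|_ xU] := boolP (x \in A); first by case: (y \in A).
have [yA|//] := boolP (y \in A).
by have := @above_not_le x y xU; rewrite inE yA xy => /(_ isT).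
Qed.

(** The factor exceeds every value of [idx], so the layer decides first. The second map runs through
    [A] backwards, as an antichain allows. *)
Definition layered x := layer x * (#|T|.+1 * #|T|) + idx x.
Definition layered_rev x := layer x * (#|T|.+1 * #|T|) +
  (if x \in A then #|T|.+1 * #|T| - idx x else idx x).

Lemma isotone_layered : isotone layered.
Proof.
apply/isotoneP => x y xy; rewrite /layered leq_add ?idx_homo //.
by rewrite leq_mul2r layer_homo ?orbT.
Qed.

Lemma isotone_layered_rev : isotone layered_rev.
Proof.
apply/isotoneP => x y xy; rewrite /layered_rev.
have [e|] := eqVneq (layer x) (layer y).
  rewrite e leq_add2l; have : (x \in A) = (y \in A).
    move: e; rewrite /layer.
    have [xD|_] := boolP (x \in D); have [yD|_] := boolP (y \in D).
    - by rewrite (negPf (below_notin xD)) (negPf (below_notin yD)).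
    - by case: (y \in A).
    - by case: (x \in A).
    - by case: (x \in A); case: (y \in A).
  move=> e'; rewrite -e'; case: ifPn => xA; last exact: idx_homo.
  have yA : y \in A by rewrite -e'.
  by rewrite (Aeq xA yA xy).
move=> nxy; have h : layer x < layer y by rewrite ltn_neqAle nxy layer_homo.
have := idx_lt x; have := idx_lt y; set B := _ * _.
set p := if _ then _ else _; set q := if _ then _ else _ => _ xB.
have pB : p <= B by rewrite /p; case: ifP => _; rewrite ?leq_subr // ltnW.
nia.
Qed.

(** The two maps are opposite on [A] but agree on [U], so inside [U] only the pairs that increase in
    [idx] are missed. *)
Lemma reverses_layered x y : ~~ le x y -> ~~ le y x ->
  [|| reverses x y layered, reverses x y layered_rev, x \in D,
      (x \in A) && (y \in U) | [&& x \in U, y \in U & idx x < idx y]].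
Proof.
move=> xy yx; have nxy : x != y by apply: contra xy => /eqP->.
have := idx_lt x; have := idx_lt y.
rewrite /reverses /layered /layered_rev /layer; set B := _ * _ => yB xB.
have [xD|xD] := boolP (x \in D); first by rewrite !orbT.
have [yD|yD] := boolP (y \in D).
  by case: ifPn => xA; apply/orP; left; lia.
have ixy : idx x != idx y by apply: contra nxy => /eqP/idx_inj->.
have := layersP x; have := layersP y; rewrite (negPf xD) (negPf yD) /=.
have [xA|xA] := boolP (x \in A); have [yA|yA] := boolP (y \in A) => /=.
- move=> _ _; apply/orP; case: (ltngtP (idx y) (idx x)) => h.
  + by left; lia.
  + by right; apply/orP; left; lia.
  + by rewrite h eqxx in ixy.
- by move=> -> _; rewrite !orbT.
- by move=> _ _; apply/orP; left; lia.
- move=> -> -> /=; case: (ltngtP (idx y) (idx x)) => h.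
  + by apply/orP; left; lia.
  + by rewrite !orbT.
  + by rewrite h eqxx in ixy.
Qed.

Lemma reverses_layered_count x y : ~~ le x y -> ~~ le y x ->
  x \notin D -> ~~ ((x \in A) && (y \in U)) ->
  ~~ [&& x \in U, y \in U & idx x < idx y] ->
  1 <= count (reverses x y) [:: layered; layered_rev].
Proof.
move=> xy yx /negPf xD /negPf xA /negPf xU; have := reverses_layered xy yx.
by rewrite xD xA xU !orbF /= => /orP[]->; rewrite ?addn1 ?addn0.
Qed.

(** * Few elements below *)

(** The down-set of [v] comes first; inside it and outside it, the up-set of [d] comes last. *)
Definition lift_below (d v z : T) : nat := 2 * dn v z + up d z.
(** First the down-set of [v], then what remains of the down-set of [u]. *)
Definition dn2 (v u z : T) : nat := dn v z + (~~ le z v && ~~ le z u).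
(** This raises what [dn2 v u] fails to put over [u], namely the elements of [A :|: U] below [v] but
    not below [u]; [d] is lifted within each half. *)
Definition separate (d u v z : T) : nat :=
  2 * [exists a in A :|: U, [&& le a v, ~~ le a u & le a z]] + up d z.

Lemma isotone_lift_below d v : isotone (lift_below d v).
Proof.
apply/isotoneP => x y xy.
by rewrite leq_add ?up_homo // leq_mul2l dn_homo.
Qed.

Lemma isotone_dn2 v u : isotone (dn2 v u).
Proof.
apply/isotoneP => x y xy; rewrite leq_add ?dn_homo //.
have := dn_homo v xy; have := dn_homo u xy; rewrite /dn.
by do 4!case: (le _ _).
Qed.

Lemma isotone_separate d u v : isotone (separate d u v).
Proof.
apply/isotoneP => x y xy; rewrite leq_add ?up_homo // leq_mul2l /=.
case: (boolP [exists a in _, _]) => // /exists_inP[a aAU /and3P[av au ax]].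
rewrite (_ : [exists b in _, _]) //; apply/exists_inP; exists a => //.
by rewrite av au (le_trans ax).
Qed.

Lemma reverses_lift_below_r d v z : ~~ le z v -> reverses z v (lift_below d v).
Proof.
rewrite /reverses /lift_below /dn /up le_refl => ->.
by case: (le d v); case: (le d z).
Qed.

Lemma reverses_lift_below_l d v z :
  ~~ le d z -> le z v -> reverses d z (lift_below d v).
Proof.
rewrite /reverses /lift_below /dn /up le_refl => /negPf-> ->.
by case: (le d v).
Qed.

Lemma reverses_dn2_l v u z : ~~ le z v -> reverses z v (dn2 v u).
Proof. by rewrite /reverses /dn2 /dn le_refl => ->. Qed.

Lemma reverses_dn2_r v u z :
  ~~ le z u -> ~~ le z v -> reverses z u (dn2 v u).
Proof.
rewrite /reverses /dn2 /dn le_refl => -> ->.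
by case: (le u v).
Qed.

Lemma reverses_separate_r d u v z : z \in A :|: U -> le z v -> ~~ le z u ->
  reverses z u (separate d u v).
Proof.
move=> zAU zv zu; rewrite /reverses /separate.
rewrite (_ : [exists b in _, _] = false); last first.
  by apply/exists_inP => -[a _ /and3P[_ /negP]].
rewrite (_ : [exists b in _, _] = true).
  by rewrite /up; case: (le d u); case: (le d z).
by apply/exists_inP; exists z; rewrite // zv zu le_refl.
Qed.

Lemma reverses_separate_l d u v z : d \in D -> ~~ le d z ->
  (z \in D) || (z \in A) && ~~ le z v -> reverses d z (separate d u v).
Proof.
move=> dD dz zDA.
have nD y : y \in D ->
    [exists a in A :|: U, [&& le a v, ~~ le a u & le a y]] = false.
  move=> yD; apply/exists_inP => -[a]; rewrite in_setU.
  case/orP=> [aA|aU] /and3P[_ _].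
    exact/negP/antichain_not_le_below.
  by apply/negP/above_not_le; rewrite // inE yD orbT.
rewrite /reverses /separate /up le_refl (negPf dz) (nD d dD).
case/orP: zDA => [/nD->//|/andP[zA zv]]; rewrite (_ : [exists a in _, _] = false) //.
apply/exists_inP => -[a]; rewrite in_setU.
case/orP=> [aA|aU] /and3P[av _ az].
  by case/negP: zv; rewrite -(Aeq aA zA az).
by have := @above_not_le a z aU; rewrite inE zA az => /(_ isT).
Qed.

(* With the extension lifting d, these cover three times every pair that needs
   one of d, u, v, at a cost of seven instead of nine. *)
Definition sextet (d u v : T) : seq (T -> nat) :=
  [:: lift_below d u; dn2 u v; separate d u v;
      lift_below d v; dn2 v u; separate d v u].

Lemma sextetC d u v p : count p (sextet d u v) = count p (sextet d v u).
Proof. by rewrite /=; lia. Qed.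

(** [lift_below d u] and [dn2 u v] always serve. The third is [separate d u v] or [dn2 v u],
    according to whether [z] is below [v]; for [z] in [D] it is left to [up z]. *)
Lemma sextet_count_above d u v z : ~~ le z u ->
  2 + (z \in A :|: U) <= count (reverses z u) (sextet d u v).
Proof.
move=> zu; rewrite /= (reverses_lift_below_r _ zu) (reverses_dn2_l _ zu).
case: (boolP (z \in A :|: U)) => zAU; last by lia.
have [zv|zv] := boolP (le z v).
  by rewrite (reverses_separate_r _ zAU zv zu); lia.
by rewrite (reverses_dn2_r zu zv); lia.
Qed.

(** Both [separate] maps serve [z] in [D]. For [z] in [A], each [w] among [u] and [v] contributes
    [lift_below d w] if [z] is below [w], and the [separate] map ending in [w] otherwise. *)
Lemma sextet_count_below d u v z : d \in D -> ~~ le d z -> z \in A :|: D ->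
  2 <= count (reverses d z) (sextet d u v).
Proof.
move=> dD dz; rewrite in_setU /=.
case: (boolP (z \in D)) => [zD _|zD].
  by rewrite !reverses_separate_l ?zD //; lia.
rewrite orbF => zA.
have h w w' : 1 <= reverses d z (lift_below d w) + reverses d z (separate d w' w).
  have [zw|zw] := boolP (le z w); first by rewrite reverses_lift_below_l.
  by rewrite (@reverses_separate_l d w' w z) ?zA ?zw ?orbT // addn1.
by move: (h u v) (h v u); clear; do 4!case: (reverses _ _ _); lia.
Qed.

Lemma dim_triples (N t : nat) (x0 : T) : dim_ge N ->
  t <= #|D| -> 2 * t <= #|U| -> 3 * N + 2 * t <= 3 * (#|U| + #|D|) + 6.
Proof.
move=> dimN tD tU.
pose ds := take t (enum D); pose ds' := drop t (enum D).
pose us := take t (enum U); pose vs := take t (drop t (enum U)).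
pose us' := drop t (drop t (enum U)).
have enumD : enum D = ds ++ ds' by rewrite cat_take_drop.
have enumU : enum U = us ++ vs ++ us' by rewrite !cat_take_drop.
have sD := cardE D; have sU := cardE U.
have sds : size ds = t by rewrite size_takel // -sD.
have sus : size us = t by rewrite size_takel -?sU; lia.
have svs : size vs = t by rewrite size_takel // size_drop -sU; lia.
have sds' : size ds' = #|D| - t by rewrite size_drop -sD.
have sus' : size us' = #|U| - 2 * t by rewrite !size_drop -sU; lia.
pose six i := sextet (nth x0 ds i) (nth x0 us i) (nth x0 vs i).
pose base := [:: layered; layered_rev].
(* A triple costs its sextet and the [up] that all of [D] receives: 7 instead of 9. Elements outside
   the triples are served three times one by one. *)
pose s := flatten (map six (iota 0 t)) ++ map up (enum D) ++
  (map up ds' ++ map up ds') ++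
  (map dn us' ++ map dn us' ++ map dn us') ++ (base ++ base ++ base).
have ss : size s = 3 * (#|U| + #|D|) + 6 - 2 * t.
  have s6 : size (flatten (map six (iota 0 t))) = 6 * t.
    rewrite -[in RHS](size_iota 0 t).
    by elim: (iota 0 t) => //= i l IH; rewrite IH; lia.
  by rewrite !size_cat s6 !size_map sds' sus' -sD /=; lia.
suff /dimN : covers 3 s by rewrite ss; lia.
split.
  rewrite !all_cat !all_isotone_up !all_isotone_dn /= isotone_layered isotone_layered_rev /=.
  rewrite andbT; elim: (iota 0 t) => //= i l ->.
  by rewrite !isotone_lift_below !isotone_dn2 !isotone_separate.
move=> x y xy yx; rewrite !count_cat.
set c1 := count _ (flatten _); set c2 := count _ (map up (enum D)).
set c3 := count _ (map up ds'); set c4 := count _ (map dn us').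
set c5 := count _ base.
have c1U : y \in U -> (2 + (x \in A :|: U) <= c1) || (1 <= c4).
  rewrite -mem_enum enumU !mem_cat orbA => /orP[yuv|yus']; apply/orP; last first.
    by right; apply: (count_map_ge1 yus'); exact: reverses_dn.
  left; case/orP: yuv => yuv.
    have it : index y us \in iota 0 t by rewrite mem_iota /= -sus index_mem.
    apply: leq_trans (count_flatten_ge _ _ it); rewrite /six nth_index //.
    exact: sextet_count_above.
  have it : index y vs \in iota 0 t by rewrite mem_iota /= -svs index_mem.
  apply: leq_trans (count_flatten_ge _ _ it); rewrite /six sextetC nth_index //.
  exact: sextet_count_above.
have [xD|xD] := boolP (x \in D).
  have h2 : 1 <= c2.
    by apply: (@count_map_ge1 _ _ _ _ _ x); rewrite ?mem_enum ?reverses_up.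
  have : x \in enum D by rewrite mem_enum.
  rewrite enumD mem_cat => /orP[xds|xds']; last first.
    have : 1 <= c3 by apply: (count_map_ge1 xds'); exact: reverses_up.
    by move: h2; clear; lia.
  have [yU|yU] := boolP (y \in U); first by move: h2 (c1U yU); clear; lia.
  have it : index x ds \in iota 0 t by rewrite mem_iota /= -sds index_mem.
  suff : 2 <= c1 by move: h2; clear; lia.
  apply: leq_trans (count_flatten_ge _ _ it); rewrite /six nth_index //.
  apply: sextet_count_below => //; rewrite in_setU orbC.
  by have := layersP y; rewrite (negPf yU) orbF.
have [yU|yU] := boolP (y \in U).
  have := c1U yU; have -> : x \in A :|: U; last by clear; lia.
  by rewrite in_setU; have := layersP x; rewrite (negPf xD).
suff : 1 <= c5 by clear; lia.
by apply: reverses_layered_count; rewrite // (negPf yU) ?andbF.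
Qed.


(** * Incomparable pairs between the antichain and the upper layer *)

Definition above_seq := sort (relpre idx leq) (enum U).

Lemma mem_above_seq x : (x \in above_seq) = (x \in U).
Proof. by rewrite mem_sort mem_enum. Qed.

Lemma size_above_seq : size above_seq = #|U|.
Proof. by rewrite size_sort cardE. Qed.

Lemma above_seq_homo x0 i j : j < #|U| -> i <= j ->
  idx (nth x0 above_seq i) <= idx (nth x0 above_seq j).
Proof.
move=> jU ij; have st : sorted (relpre idx leq) above_seq.
  by apply: sort_sorted => x y; exact: leq_total.
have tr : transitive (relpre idx leq) by move=> y x z; exact: leq_trans.
have rf : reflexive (relpre idx leq) by move=> x; exact: leqnn.
apply: (sorted_leq_nth tr rf x0 st) => //; rewrite inE size_above_seq //.
exact: leq_ltn_trans jU.
Qed.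

(** This is what lets one [up_dn] serve two consecutive elements in the ladder. *)
Lemma above_seq_not_le x0 i : i.+1 < #|U| ->
  ~~ le (nth x0 above_seq i.+1) (nth x0 above_seq i).
Proof.
move=> iU; apply/negP => /idx_homo h.
have /idx_inj/eqP : idx (nth x0 above_seq i) = idx (nth x0 above_seq i.+1).
  by apply/eqP; rewrite eqn_leq h above_seq_homo.
rewrite nth_uniq ?size_above_seq // ?(ltnW iU) ?sort_uniq ?enum_uniq //.
by rewrite eqn_leq ltnn andbF.
Qed.

(* Each u is put once at the bottom and once at the top. The only pair served
   twice by the same extension is (u_(i+1), u_i), which layered reverses. *)
Definition ladder x0 : seq (T -> nat) :=
  up (nth x0 above_seq 0) :: mkseq (fun i =>
    if i.+1 < #|U| then up_dn (nth x0 above_seq i.+1) (nth x0 above_seq i)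
    else dn (nth x0 above_seq i)) #|U|.

Lemma size_ladder x0 : size (ladder x0) = #|U|.+1.
Proof. by rewrite /= size_mkseq. Qed.

Lemma all_isotone_ladder x0 : all isotone (ladder x0).
Proof.
rewrite /= isotone_up all_map; apply/allP => i _ /=.
by case: ifP => _; [exact: isotone_up_dn|exact: isotone_dn].
Qed.

Lemma ladder_reverses_dn x0 x y : y \in U -> ~~ le x y ->
  let i := index y above_seq in
  reverses x y (if i.+1 < #|U|
    then up_dn (nth x0 above_seq i.+1) (nth x0 above_seq i)
    else dn (nth x0 above_seq i)).
Proof.
rewrite -mem_above_seq => yU xy /=; case: ifPn => iU.
  have := above_seq_not_le x0 iU; rewrite !nth_index // => h.
  exact: reverses_up_dn_r.
by rewrite nth_index // reverses_dn.
Qed.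

Lemma index_above_seq x : x \in U -> index x above_seq \in iota 0 #|U|.
Proof. by rewrite -mem_above_seq mem_iota /= -size_above_seq index_mem. Qed.

Lemma count_ladder_ge1 x0 x y : y \in U -> ~~ le x y ->
  1 <= count (reverses x y) (ladder x0).
Proof.
move=> yU xy; rewrite /=; apply: leq_trans (leq_addl _ _).
apply: (count_map_ge1 (index_above_seq yU)); exact: ladder_reverses_dn.
Qed.

(** One member lifts [x] and one lowers [y]. They could coincide only if [x] came right after [y],
    against the order of [idx]. *)
Lemma count_ladder_ge2 x0 x y : x \in U -> y \in U -> ~~ le x y ->
  idx x < idx y -> 2 <= count (reverses x y) (ladder x0).
Proof.
move=> xU yU xy ixy; have yi := index_above_seq yU; have xi := index_above_seq xU.
have ltxy : index x above_seq < index y above_seq.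
  rewrite ltnNge; apply/negP => h.
  have jU : index x above_seq < #|U| by move: xi; rewrite mem_iota.
  have := above_seq_homo x0 jU h; rewrite !nth_index ?mem_above_seq //.
  by rewrite leqNgt ixy.
case e : (index x above_seq) => [|i].
  have x_0 : nth x0 above_seq 0 = x by rewrite -e nth_index ?mem_above_seq.
  rewrite /= x_0 (reverses_up xy) add1n ltnS.
  by apply: (count_map_ge1 yi); exact: ladder_reverses_dn.
have iU : i.+1 < #|U| by move: xi; rewrite e mem_iota.
apply: leq_trans (leq_addl _ _).
apply: (@count_map_ge2 _ _ _ _ _ i (index y above_seq)) => //.
- by rewrite mem_iota /= ltnW.
- by rewrite neq_ltn -ltnS -e ltnS ltnW.
- rewrite /= iU -e nth_index ?mem_above_seq //; apply: reverses_up_dn_l => //.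
  by have := above_seq_not_le x0 iU; rewrite -e nth_index ?mem_above_seq.
- exact: ladder_reverses_dn.
Qed.

(** * Disjoint paths with two edges *)

Definition edge (e : T * T) := [&& e.1 \in A, e.2 \in U & ~~ le e.1 e.2].
Definition ends1 (EE : {set T * T}) := [set e.1 | e in EE].
Definition ends2 (EE : {set T * T}) := [set e.2 | e in EE].

(* A union of K vertex-disjoint paths with two edges has these properties. *)
Definition cherries (EE : {set T * T}) (K : nat) :=
  [&& [forall e in EE, edge e], #|EE| <= 2 * K,
      3 * K <= #|ends1 EE| + #|ends2 EE|
    & [forall e in EE, exists f in EE,
         (f != e) && ((f.1 == e.1) || (f.2 == e.2))]].

Definition far (EE : {set T * T}) :=
  [set e | [&& edge e, e.1 \notin ends1 EE & e.2 \notin ends2 EE]].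

(** With [K] maximal, two distinct far edges sharing an end would form one more path. *)
Lemma cherries_max : exists EE K, cherries EE K /\
  {in far EE &, forall e f, (e.1 == f.1) || (e.2 == f.2) -> e = f}.
Proof.
have ex : exists K, [exists EE, cherries EE K].
  exists 0; apply/existsP; exists set0; rewrite /cherries cards0 muln0 /=.
  by apply/andP; split; apply/forall_inP => e; rewrite inE.
have bound K : [exists EE, cherries EE K] -> K <= #|T|.
  case/existsP => EE /and4P[_ _ h _].
  have := max_card (ends1 EE); have := max_card (ends2 EE); lia.
have [K /existsP[EE ch] Kmax] := ex_maxnP ex bound.
exists EE, K; split=> // e f; rewrite !inE.
case/and3P=> ee e1 e2 /and3P[fe f1 f2] sh; apply/eqP; apply: contraT => nef.
suff /Kmax : [exists EE, cherries EE K.+1] by rewrite ltnn.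
have /and4P[/forall_inP edg cE cV /forall_inP iso] := ch.
apply/existsP; exists ([set e; f] :|: EE); apply/and4P; split.
- apply/forall_inP => g; rewrite !inE => /orP[/orP[]/eqP->//|]; exact: edg.
- by apply: leq_trans (leq_card_setU _ _) _; rewrite cards2 nef; move: cE; clear; lia.
- have i1 : ends1 ([set e; f] :|: EE) = [set e.1; f.1] :|: ends1 EE.
    by rewrite /ends1 imsetU imsetU1 imset_set1.
  have i2 : ends2 ([set e; f] :|: EE) = [set e.2; f.2] :|: ends2 EE.
    by rewrite /ends2 imsetU imsetU1 imset_set1.
  have d1 : [set e.1; f.1] :&: ends1 EE = set0.
    apply/setP => z; rewrite in_setI in_set0 in_set2.
    by apply/negP => /andP[/orP[]/eqP->]; exact/negP.
  have d2 : [set e.2; f.2] :&: ends2 EE = set0.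
    apply/setP => z; rewrite in_setI in_set0 in_set2.
    by apply/negP => /andP[/orP[]/eqP->]; exact/negP.
  rewrite i1 i2 (cardsU _ (ends1 EE)) (cardsU _ (ends2 EE)) d1 d2 cards0 !cards2.
  (* Hence the two new edges have at least three ends in all. *)
  have : (e.1 != f.1) || (e.2 != f.2).
    rewrite -negb_and; apply: contra nef => /andP[/eqP h1 /eqP h2].
    by rewrite [e]surjective_pairing h1 h2 -surjective_pairing.
  move: cV; clear; lia.
- apply/forall_inP => g; rewrite !inE => /orP[/orP[]/eqP->|gE].
  + by apply/exists_inP; exists f; rewrite ?inE ?eqxx ?orbT // eq_sym nef /=
      eq_sym [_ == e.2]eq_sym.
  + by apply/exists_inP; exists e; rewrite ?inE ?eqxx ?orbT // nef.
  + have /exists_inP[h hE hg] := iso _ gE.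
    by apply/exists_inP; exists h; rewrite // !inE hE orbT.
Qed.

Lemma ends1_sub EE K : cherries EE K -> ends1 EE \subset A.
Proof.
case/and4P=> /forall_inP edg _ _ _.
by apply/subsetP => _ /imsetP[e /edg/and3P[h _ _] ->].
Qed.

Lemma ends2_sub EE K : cherries EE K -> ends2 EE \subset U.
Proof.
case/and4P=> /forall_inP edg _ _ _.
by apply/subsetP => _ /imsetP[e /edg/and3P[_ h _] ->].
Qed.

Local Notation edge_ext := (fun e : T * T => up_dn e.1 e.2).

Lemma edge_ext_reverses e x y : edge e -> ~~ le x y ->
  (e.1 == x) || (e.2 == y) -> reverses x y (edge_ext e).
Proof.
case/and3P=> _ _ h xy /orP[]/eqP e1.
  by rewrite -e1 /= reverses_up_dn_l // e1.
by rewrite -e1 /= reverses_up_dn_r // e1.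
Qed.

Lemma all_isotone_edge_ext l : all isotone (map edge_ext l).
Proof. by rewrite all_map; apply/allP => e _; exact: isotone_up_dn. Qed.

Lemma count_edge_ext_ge1 (EE : {set T * T}) x y : {in EE, forall e, edge e} ->
  ~~ le x y -> (x \in ends1 EE) || (y \in ends2 EE) ->
  1 <= count (reverses x y) (map edge_ext (enum EE)).
Proof.
move=> edg xy /orP[]/imsetP[e eE ev];
  (apply: (@count_map_ge1 _ _ _ _ _ e); rewrite ?mem_enum //);
  by apply: edge_ext_reverses; rewrite ?edg // ev eqxx ?orbT.
Qed.

(** Besides the ladder, a threefold cover lifts each element of [A] once and lowers each of [U]
    once. On a path two edge extensions do this for three elements, which saves [K]. *)
Lemma dim_cherries N EE K (x0 : T) : dim_ge N -> cherries EE K ->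
  3 * N + K <= #|A| + 2 * #|U| + 3 * #|D| + 7.
Proof.
move=> dimN ch; have /and4P[/forall_inP edg cE cV /forall_inP iso] := ch.
have s1 := ends1_sub ch; have s2 := ends2_sub ch.
pose base := [:: layered; layered_rev].
pose extE := map edge_ext (enum EE).
have sE : size extE <= 2 * K by rewrite size_map -cardE.
pose s := extE ++ map up (enum (A :\: ends1 EE)) ++
  map dn (enum (U :\: ends2 EE)) ++ ladder x0 ++
  (map up (enum D) ++ map up (enum D) ++ map up (enum D)) ++
  (base ++ base ++ base).
have ss : size s + K <= #|A| + 2 * #|U| + 3 * #|D| + 7.
  have e1 : size (enum (A :\: ends1 EE)) = #|A| - #|ends1 EE|.
    by rewrite -cardE cardsD (setIidPr s1).
  have e2 : size (enum (U :\: ends2 EE)) = #|U| - #|ends2 EE|.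
    by rewrite -cardE cardsD (setIidPr s2).
  rewrite !size_cat size_ladder; move: sE; set p := size extE => sE.
  rewrite !size_map e1 e2 -(cardE D) /=.
  move: (subset_leq_card s1) (subset_leq_card s2) sE cV; clear; lia.
suff /dimN : covers 3 s by lia.
split.
  rewrite !all_cat !all_isotone_edge_ext !all_isotone_up !all_isotone_dn.
  by rewrite all_isotone_ladder /= isotone_layered isotone_layered_rev.
move=> x y xy yx; rewrite !count_cat.
set c1 := count _ extE; set c2 := count _ (map up (enum (_ :\: _))).
set c3 := count _ (map dn _); set c4 := count _ (ladder _).
set c5 := count _ (map up (enum D)); set c6 := count _ base.
have [xD|xD] := boolP (x \in D).
  suff : 1 <= c5 by clear; lia.
  by apply: (@count_map_ge1 _ _ _ _ _ x); rewrite ?mem_enum ?reverses_up.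
have h1 : (x \in ends1 EE) || (y \in ends2 EE) -> 1 <= c1.
  by apply: count_edge_ext_ge1.
have h3 : y \in U -> y \notin ends2 EE -> 1 <= c3.
  move=> yU yE; apply: (@count_map_ge1 _ _ _ _ _ y); last exact: reverses_dn.
  by rewrite mem_enum in_setD yE.
have [/andP[xA yU]|nAU] := boolP ((x \in A) && (y \in U)).
  have h4 : 1 <= c4 by exact: count_ladder_ge1.
  have [xE|xE] := boolP (x \in ends1 EE); last first.
    have h2 : 1 <= c2.
      apply: (@count_map_ge1 _ _ _ _ _ x); last exact: reverses_up.
      by rewrite mem_enum in_setD xE.
    have [yE|yE] := boolP (y \in ends2 EE).
      by have := h1; rewrite yE orbT => /(_ isT); move: h2 h4; clear; lia.
    by move: h2 h4 (h3 yU yE); clear; lia.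
  have h1' := h1; rewrite xE in h1'; have {}h1' := h1' isT.
  have [yE|yE] := boolP (y \in ends2 EE); last first.
    by move: h1' h4 (h3 yU yE); clear; lia.
  (* Edges of [EE] at [x] and at [y] serve the pair; if they coincide, an edge of [EE] sharing an
     end is the second one. *)
  suff : 2 <= c1 by move: h4; clear; lia.
  have /imsetP[e eE xe] := xE; have /imsetP[f fE yf] := yE.
  have re : reverses x y (edge_ext e).
    by apply: edge_ext_reverses; rewrite ?edg // xe eqxx.
  have rf : reverses x y (edge_ext f).
    by apply: edge_ext_reverses; rewrite ?edg // yf eqxx orbT.
  have [ef|ef] := eqVneq e f; last first.
    by apply: (@count_map_ge2 _ _ _ _ _ e f); rewrite ?mem_enum.
  have /exists_inP[g gE /andP[ge gs]] := iso _ eE.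
  apply: (@count_map_ge2 _ _ _ _ _ g e); rewrite ?mem_enum //.
  by apply: edge_ext_reverses; rewrite ?edg // xe yf -ef.
have [/and3P[xU yU ixy]|nUU] := boolP [&& x \in U, y \in U & idx x < idx y].
  have h4 : 2 <= c4 by exact: count_ladder_ge2.
  have [yE|yE] := boolP (y \in ends2 EE).
    by have := h1; rewrite yE orbT => /(_ isT); move: h4; clear; lia.
  by move: h4 (h3 yU yE); clear; lia.
suff : 1 <= c6 by clear; lia.
exact: reverses_layered_count.
Qed.

(** In a twofold cover the ladder serves each edge once; the second time comes from an edge of [EE]
    with a common end, or from the edge itself if it is far. *)
Lemma dim_far N EE K (x0 : T) : dim_ge N -> cherries EE K ->
  2 * N <= #|far EE| + 2 * K + #|U| + 2 * #|D| + 5.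
Proof.
move=> dimN ch; have /and4P[/forall_inP edg cE _ _] := ch.
pose base := [:: layered; layered_rev].
pose extE := map edge_ext (enum EE); pose extF := map edge_ext (enum (far EE)).
have sE : size extE <= 2 * K by rewrite size_map -cardE.
have sF : size extF = #|far EE| by rewrite size_map -cardE.
pose s := extE ++ extF ++
  ladder x0 ++ (map up (enum D) ++ map up (enum D)) ++ (base ++ base).
have ss : size s <= #|far EE| + 2 * K + #|U| + 2 * #|D| + 5.
  rewrite !size_cat size_ladder sF; move: sE; set p := size extE => sE.
  rewrite !size_map -(cardE D) /=.
  move: sE; clear; lia.
suff /dimN : covers 2 s by lia.
split.
  rewrite !all_cat !all_isotone_edge_ext !all_isotone_up.
  by rewrite all_isotone_ladder /= isotone_layered isotone_layered_rev.
move=> x y xy yx; rewrite !count_cat.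
set c1 := count _ extE; set c2 := count _ extF.
set c4 := count _ (ladder _).
set c5 := count _ (map up (enum D)); set c6 := count _ base.
have [xD|xD] := boolP (x \in D).
  suff : 1 <= c5 by clear; lia.
  by apply: (@count_map_ge1 _ _ _ _ _ x); rewrite ?mem_enum ?reverses_up.
have [/andP[xA yU]|nAU] := boolP ((x \in A) && (y \in U)).
  have h4 : 1 <= c4 by exact: count_ladder_ge1.
  suff : (1 <= c1) || (1 <= c2) by move: h4; clear; lia.
  have [h|] := boolP ((x \in ends1 EE) || (y \in ends2 EE)).
    by rewrite count_edge_ext_ge1.
  rewrite negb_or => /andP[xE yE].
  have exy : edge (x, y) by apply/and3P.
  rewrite (_ : 1 <= c2) ?orbT //.
  apply: (@count_map_ge1 _ _ _ _ _ (x, y)).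
    by rewrite mem_enum inE exy xE.
  by apply: edge_ext_reverses; rewrite ?eqxx.
have [/and3P[xU yU ixy]|nUU] := boolP [&& x \in U, y \in U & idx x < idx y].
  suff : 2 <= c4 by clear; lia.
  exact: count_ladder_ge2.
suff : 1 <= c6 by clear; lia.
exact: reverses_layered_count.
Qed.


(** * Extraction of the standard example *)

Lemma standard_far EE :
  {in far EE &, forall e f, (e.1 == f.1) || (e.2 == f.2) -> e = f} ->
  standard_in #|far EE|.
Proof.
move=> mat; exists (fun i => (enum_val i).1), (fun i => (enum_val i).2) => i j.
have farP k : [/\ edge (@enum_val _ (mem (far EE)) k),
    (enum_val k).1 \notin ends1 EE & (enum_val k).2 \notin ends2 EE].
  by have := enum_valP k; rewrite inE => /and3P.
have [/and3P[iA iU ile] i1 i2] := farP i; have [/and3P[jA jU jle] j1 j2] := farP j.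
(* Otherwise the [A]-end of edge [k] and the [U]-end of edge [l] form a far edge, which the matching
   property identifies with both. *)
have cross k l : k != l ->
    le (@enum_val _ (mem (far EE)) k).1 (@enum_val _ (mem (far EE)) l).2.
  move=> kl; apply: contraT => nle.
  have [/and3P[kA kU _] k1 k2] := farP k; have [/and3P[lA lU _] l1 l2] := farP l.
  have h : ((enum_val k).1, (enum_val l).2) \in far EE.
    by rewrite inE; apply/and3P; split=> //; apply/and3P.
  have e1 := mat _ _ h (enum_valP k); rewrite /= eqxx in e1.
  have e2 := mat _ _ h (enum_valP l); rewrite /= eqxx orbT in e2.
  by case/eqP: kl; apply: enum_val_inj; rewrite -(e1 isT) (e2 isT).
split.
- have [<-|/cross->//] := eqVneq i j; exact: (negPf ile).
- by apply: negbTE; apply: above_not_le => //; rewrite inE jA.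
- have [->|ij] := eqVneq i j; first exact: le_refl.
  apply/negP => /(Aeq iA jA) e; case/eqP: ij; apply: enum_val_inj.
  by apply: mat; rewrite ?enum_valP // e eqxx.
- have [->|ij] := eqVneq i j; first exact: le_refl.
  apply/negP => uij; move/negP: jle; apply; apply: le_trans uij.
  by apply: cross; rewrite eq_sym.
Qed.

Lemma standard_of_small_below (n c : nat) :
  10 * (30 * c + 52) < n -> #|T| <= 2 * n + 1 -> dim_ge (n - c) ->
  n - c <= #|A| -> #|D| <= #|U| ->
  exists2 M, n - (30 * c + 52) <= M & standard_in M.
Proof.
move=> n_gt cardT dimN cardA cardDU.
have [x0 _] : exists x, x \in A by apply/card_gt0P; lia.
have cT := card_layers.
(* Without triples this gives [|U| + |D| >= n - c - 2], so [U], the larger part, has room for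
   [2 * (3 * c + 5)] elements. *)
have t0 := dim_triples x0 dimN (leq0n _) (leq0n _).
have cD : #|D| <= 3 * c + 4.
  rewrite leqNgt; apply/negP => D_gt.
  have U_ge : 2 * (3 * c + 5) <= #|U| by lia.
  (* As [|U| + |D| <= n + c + 1], [t] triples require [2 * t <= 6 * c + 9]; this [t] is the least
     one that fails. *)
  have := dim_triples (t := 3 * c + 5) x0 dimN; rewrite U_ge addnS D_gt.
  move/(_ isT isT); lia.
have [EE [K [ch mat]]] := cherries_max.
have hK := dim_cherries x0 dimN ch.
have hM := dim_far x0 dimN ch.
exists #|far EE|; last exact: standard_far.
(* Here [K <= 7 * c + 13], so at least [n - 20 * c - 36] edges are far. *)
move: #|far EE| hM => M hM; clear mat ch; lia.
Qed.

End Layers.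
End Poset.

(** * Duality *)

Lemma dim_ge_dual (T : finType) (le : rel T) (N : nat) :
  dim_ge le N -> dim_ge (fun x y => le y x) N.
Proof.
move=> dimN k s [mono cov].
(* Subtraction from the maximum turns the levels upside down. *)
pose dual (g : T -> nat) x := \max_y g y - g x.
rewrite -(size_map dual s); apply: dimN; split=> [|x y xy yx].
  rewrite all_map; apply: sub_all mono => g /isotoneP h.
  by apply/isotoneP => x y /h gxy; rewrite leq_sub2l.
rewrite count_map (leq_trans (cov _ _ xy yx)) //; apply: sub_count => g /= gxy.
rewrite /reverses /dual in gxy *.
have := leq_bigmax y (F := g); have := leq_bigmax x (F := g); lia.
Qed.

Lemma standard_in_dual (T : finType) (le : rel T) (M : nat) :
  standard_in (fun x y => le y x) M -> standard_in le M.
Proof.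
move=> [a [u h]]; exists u, a => i j; have [h1 h2 h3 h4] := h j i.
by rewrite h1 h2 h3 h4 eq_sym; split.
Qed.

Lemma standard_of_dim (T : finType) (le : rel T) (n c : nat) :
  reflexive le -> antisymmetric le -> transitive le ->
  10 * (30 * c + 52) < n -> #|T| <= 2 * n + 1 -> dim_ge le (n - c) ->
  exists2 M, n - (30 * c + 52) <= M & standard_in le M.
Proof.
move=> le_refl le_anti le_trans n_gt cardT dimN.
have [A [Aa cardA Amax]] := dim_le_width le_refl le_anti le_trans dimN.
have [h|/ltnW h] := leqP #|below le A| #|above le A|.
  exact: (standard_of_small_below le_refl le_anti le_trans Aa Amax n_gt).
(* [below] and [above] of the dual order are convertible to [above] and [below] of [le], so [h] has
   the required type. *)
have [||||M MN /standard_in_dual stM] :=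
  @standard_of_small_below T (fun x y => le y x) le_refl _ _ A _ _ n c n_gt cardT
    (dim_ge_dual dimN) cardA h.
- by move=> x y; rewrite andbC; exact: le_anti.
- by move=> y x z xy yz; exact: le_trans yz xy.
- apply/antichainP => x y xA yA yx; apply/esym.
  by move/antichainP: Aa; apply.
- by move=> x; have [a aA] := Amax x; rewrite orbC; exists a.
by exists M.
Qed.

(** * From fractional dimension to covers *)

From mathcomp Require Import all_order all_algebra.
From mathcomp Require Import all_classical all_reals all_analysis.

Import Order.TTheory GRing.Theory Num.Theory.

Local Open Scope ring_scope.

(** Comparing levels first and [P] within a level gives a partial order, whose total refinements
    only break ties inside levels. *)
Lemma linear_extension_of_isotone (disp : Order.disp_t)
    (P : finPOrderType disp) (g : P -> nat) :
  (forall x y : P, (x <= y)%O -> (g x <= g y)%N) ->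
  exists L : linear_extension P,
    forall x y, (g y < g x)%N -> gt_in L x y.
Proof.
move=> mono.
pose L0 : {set P * P} :=
  [set p | (g p.1 < g p.2)%N || (g p.1 == g p.2) && (p.1 <= p.2)%O]%SET.
have L0P x y : ((x, y) \in L0) =
  (g x < g y)%N || (g x == g y) && (x <= y)%O by rewrite inE.
have L0o : is_partial_order L0.
  split=> [x|x y|x y z]; rewrite !L0P ?eqxx ?lexx ?orbT //.
    case/orP=> [xy|/andP[/eqP xy lexy]] /orP[yx|/andP[/eqP yx leyx]]; try lia.
    by apply/eqP; rewrite eq_le lexy.
  case/orP=> [xy|/andP[/eqP xy lexy]] /orP[yz|/andP[/eqP yz leyz]]; apply/orP.
  - by left; lia.
  - by left; lia.
  - by left; lia.
  - by right; rewrite xy yz eqxx (le_trans lexy).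
have [L [Lo L0L Ltot]] := partial_order_total L0o.
have Ll : `[< is_linear_extension L >].
  apply/asboolP; split=> // x y xy; apply: (fintype.subsetP L0L); rewrite L0P xy.
  by rewrite andbT orbC -leq_eqVlt mono.
exists (exist _ L Ll) => x y gyx; rewrite /gt_in /=.
rewrite (fintype.subsetP L0L) ?L0P ?gyx // andbT.
by apply: contraTneq gyx => ->; rewrite ltnn.
Qed.

Lemma sum_count_mem (I : finType) (p : pred I) (s : seq I) :
  (\sum_(i | p i) count_mem i s)%N = count p s.
Proof.
elim: s => [|x s IH] /=; first by rewrite big1.
rewrite big_split /= IH; congr addn.
rewrite -big_mkcondr /=.
case: (boolP (p x)) => px; last first.
  by rewrite big_pred0 // => i; case: eqVneq => [<-|]; rewrite ?(negPf px) ?andbF.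
by rewrite (big_pred1 x) // => i /=; case: eqVneq => [<-|]; rewrite ?px ?andbF.
Qed.

(** Each linear extension gets its multiplicity in the list, divided by [k], as weight. *)
Lemma fdim_le_cover (R : realType) (disp : Order.disp_t)
    (P : finPOrderType disp) (k : nat) (s : seq (P -> nat)) :
  covers (fun x y : P => (x <= y)%O) k s -> k%:R * fdim R P <= (size s)%:R.
Proof.
case: k => [|k] [mono cov]; first by rewrite mul0r ler0n.
have [g|ext extP] := @choice (P -> nat) (linear_extension P) (fun g L =>
    isotone (fun x y : P => (x <= y)%O) g ->
    forall x y, (g y < g x)%N -> gt_in L x y).
  have [/isotoneP gm|gm] := boolP (isotone (fun x y : P => (x <= y)%O) g).
    by have [L LP] := linear_extension_of_isotone gm; exists L.
  (* Default value for maps that are not isotone: a linear extension obtained from a constant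
     map. *)
  have [|L _] := @linear_extension_of_isotone _ P (fun=> 0%N); first by [].
  by exists L.
pose t := map ext s.
pose alpha (L : linear_extension P) : R := (count_mem L t)%:R / k.+1%:R.
have sum_alpha (p : pred (linear_extension P)) :
    \sum_(L | p L) alpha L = (count p t)%:R / k.+1%:R.
  by rewrite -mulr_suml -natr_sum sum_count_mem.
have wt : @fractional_weight R disp P ((size s)%:R / k.+1%:R).
  exists alpha; last by rewrite sum_alpha count_predT size_map.
  split=> [L|x y xy]; first by rewrite divr_ge0 ?ler0n.
  rewrite sum_alpha ler_pdivlMr ?ltr0n // mul1r ler_nat.
  move: xy; rewrite /Order.comparable negb_or => /andP[xy yx].
  apply: leq_trans (cov x y xy yx) _; rewrite count_map.
  elim: s mono {cov t alpha sum_alpha} => //= g s IH /andP[gm /IH h].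
  apply: leq_add => //; case: (boolP (reverses x y g)) => // r.
  by rewrite extP.
have [_ lb] := fdim_least R P.
by have := lb _ wt; rewrite ler_pdivlMr ?ltr0n // mulrC.
Qed.

Theorem theorem4p6 (R : realType) (c : nat) (c_gt0 : (0 < c)%N) (n : nat)
    (n_gt : (10 * (30 * c + 52) < n)%N)
    (disp : Order.disp_t) (P : finPOrderType disp)
    (card_P : (#|{: P}| <= 2 * n + 1)%N)
    (fdim_P : n%:R - c%:R <= fdim R P) :
  exists2 d : nat, (n - (30 * c + 52) <= d)%N & contains_standard_example P d.
Proof.
have [||||M MN [a [u h]]] :=
  @standard_of_dim P (fun x y => (x <= y)%O) n c _ _ _ n_gt card_P.
- exact: lexx.
- exact: le_anti.
- exact: le_trans.
- move=> k s /(fdim_le_cover R) h; rewrite -(ler_nat R).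
  (* Since [c <= n], the truncated [n - c] agrees with the real difference. *)
  apply: le_trans h; rewrite natrM ler_wpM2l ?ler0n // natrB //; lia.
exists M => //; exists (fun z => match z with inl i => a i | inr j => u j end).
by move=> [i|i] [j|j] /=; have [h1 h2 h3 h4] := h i j; rewrite ?h1 ?h2 ?h3 ?h4.
Qed.
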